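(* Let $l\ge 0$, let $d_l=\dim\mathcal{A}_l=\frac{(l+1)(l+2)}{2}$, and let $\mathscr{F}_l:\mathcal{A}_l\to\mathbb{Q}^{d_l}$ be the coordinate isomorphism given by the monomial basis. Let $D$ be the matrix of $\Delta_Q:\mathcal{A}_l\to\mathcal{A}_{l-2}$ in the monomial bases. Let $A$ (respectively $A_+$, $A_-$) be the $d_l\times d_l$ matrix of $\mathrm{Ave}_l$ (respectively $\mathrm{Ave}_{l,+}$, $\mathrm{Ave}_{l,-}$) in the monomial basis of $\mathcal{A}_l$. (i) Let $B$ be the matrix formed by columns of $A$ that form a basis of the column space of $A$, and let $\mathbf{v}_1,\dots,\mathbf{v}_t$ be a basis of the solution space $\{z : DBz=0\}$. Then $\mathscr{F}_l^{-1}(B\mathbf{v}_1),\dots,\mathscr{F}_l^{-1}(B\mathbf{v}_t)$ is a basis of $\mathcal{H}_l^\Gamma$. (ii) For each sign $\pm$, let $B_\pm$ be the matrix formed by columns of $A_\pm$ that form a basis of the column space of $A_\pm$, and let $\mathbf{v}_1^\pm,\dots,\mathbf{v}_{t_\pm}^\pm$ be a basis of $\{z : DB_\pm z=0\}$. Then $\mathscr{F}_l^{-1}(B_\pm\mathbf{v}_1^\pm),\dots,\mathscr{F}_l^{-1}(B_\pm\mathbf{v}_{t_\pm}^\pm)$ is a basis of $\mathcal{H}_{l,\pm}^\Gamma$.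
   Context: Let $D_{\mathrm{alg}}=\mathbb{Q}+\mathbb{Q}i+\mathbb{Q}j+\mathbb{Q}ij$ be the quaternion algebra over $\mathbb{Q}$ with $i^2=j^2=-1$, $ij=-ji$, with involution $\iota(a_0+a_1i+a_2j+a_3ij)=a_0-a_1i-a_2j-a_3ij$, $\mathrm{Tr}(x)=x+\iota(x)$, $\mathrm{Nm}(x)=x\,\iota(x)$. Let $\mathcal{O}=\mathbb{Z}+\mathbb{Z}i+\mathbb{Z}j+\mathbb{Z}w$ with $w=(1+i+j+ij)/2$ (the Hurwitz maximal order). Let $V=\{x\in D_{\mathrm{alg}}\mid \mathrm{Tr}(x)=0\}$, with basis $\mathbf{b}_1=-i+j+ij$, $\mathbf{b}_2=i-j+ij$, $\mathbf{b}_3=i+j-ij$; identify $x_1\mathbf{b}_1+x_2\mathbf{b}_2+x_3\mathbf{b}_3\in V$ with the row vector $x=(x_1,x_2,x_3)$. For $g\in D_{\mathrm{alg}}^\times$ let $\mathcal{F}(g)\in\mathrm{SL}_3(\mathbb{Q})$ be the matrix such that the map $x\mapsto g^{-1}xg$ on $V$ is $x\mapsto x\,\mathcal{F}(g)$ on row vectors. Put $\Gamma=\mathcal{F}(\mathcal{O}^\times)$, a finite group of order $12$, and $\gamma_2=\mathcal{F}(i-j)$. Let $\mathcal{A}_l$ be the $\mathbb{Q}$-space of homogeneous polynomials of degree $l$ in $\mathbb{Q}[x_1,x_2,x_3]$ (including $0$; $\mathcal{A}_l=0$ for $l<0$), with monomial basis $x_1^{l_1}x_2^{l_2}x_3^{l_3}$,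 $l_1+l_2+l_3=l$, in some fixed order. Let $\Delta_Q=\frac12\left(\frac{\partial^2}{\partial x_1^2}+\frac{\partial^2}{\partial x_2^2}+\frac{\partial^2}{\partial x_3^2}+\frac{\partial^2}{\partial x_1\partial x_2}+\frac{\partial^2}{\partial x_2\partial x_3}+\frac{\partial^2}{\partial x_3\partial x_1}\right)$, $\mathcal{H}_l=\{f\in\mathcal{A}_l\mid\Delta_Qf=0\}$, and $\mathcal{H}_l^\Gamma=\{f\in\mathcal{H}_l\mid f(x\gamma)=f(x)\ \forall\gamma\in\Gamma\}$. Let $\mathfrak{T}_2=\{\mathcal{F}(y)\mid y\in\mathcal{O},\ \mathrm{Nm}(y)=2\}$ (which equals $\Gamma\gamma_2=\gamma_2\Gamma$) and define $T_2$ on $\mathcal{H}_l^\Gamma$ by $(T_2f)(x)=\sum_{\gamma\in\Gamma\backslash\mathfrak{T}_2}f(x\gamma^{-1})$. Set $\mathcal{H}_{l,\pm}^\Gamma=\{f\in\mathcal{H}_l^\Gamma\mid T_2f=\pm(-1)^lf\}$. For $\gamma\in\mathrm{GL}_3(\mathbb{Q})$ put $(\gamma\cdot f)(x)=f(x\gamma)$, and define linear maps $\mathcal{A}_l\to\mathcal{A}_l$ by $\mathrm{Ave}_l(f)=\sum_{\gamma\in\Gamma}\gamma\cdot f$ and $\mathrm{Ave}_{l,\pm}(f)=\sum_{\gamma\in\Gamma}\gamma\cdot f\pm(-1)^l\sum_{\gamma\in\Gamma\gamma_2}\gamma\cdot f$ (double signs in the same order). Vectors in $\mathbb{Q}^n$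 are column vectors. *)

(* Defs.v *)
From HB Require Import structures.
From mathcomp Require Import all_boot all_order all_algebra.
From mathcomp Require Import mpoly.
From mathcomp Require Import ring lra.
From mathcomp Require Import boolp classical_sets functions cardinality fsbigop.

Set Implicit Arguments.
Unset Strict Implicit.
Unset Printing Implicit Defensive.

Import Order.TTheory GRing.Theory Num.Theory.
Local Open Scope classical_set_scope.
Local Open Scope ring_scope.

(* [Quat a0 a1 a2 a3] stands for [a0 + a1 i + a2 j + a3 ij] in D_alg. *)
Record quat := Quat { q0 : rat; q1 : rat; q2 : rat; q3 : rat }.

Definition quat_code (x : quat) := (q0 x, q1 x, q2 x, q3 x).
Definition quat_decode (t : rat * rat * rat * rat) :=
  let: (a, b, c, d) := t in Quat a b c d.
Lemma quat_codeK : cancel quat_code quat_decode. Proof. by case. Qed.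
HB.instance Definition _ := Choice.copy quat (can_type quat_codeK).

Definition addq x y :=
  Quat (q0 x + q0 y) (q1 x + q1 y) (q2 x + q2 y) (q3 x + q3 y).
Definition oppq x := Quat (- q0 x) (- q1 x) (- q2 x) (- q3 x).
Definition scaleq a x := Quat (a * q0 x) (a * q1 x) (a * q2 x) (a * q3 x).
Definition mulq x y := Quat
  (q0 x * q0 y - q1 x * q1 y - q2 x * q2 y - q3 x * q3 y)
  (q0 x * q1 y + q1 x * q0 y + q2 x * q3 y - q3 x * q2 y)
  (q0 x * q2 y - q1 x * q3 y + q2 x * q0 y + q3 x * q1 y)
  (q0 x * q3 y + q1 x * q2 y - q2 x * q1 y + q3 x * q0 y).
Definition conjq x := Quat (q0 x) (- q1 x) (- q2 x) (- q3 x).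
Definition normq x := q0 x ^+ 2 + q1 x ^+ 2 + q2 x ^+ 2 + q3 x ^+ 2.
Definition invq x := scaleq (normq x)^-1 (conjq x).

Ltac quat_ring := repeat case=> ? ? ? ?;
  rewrite /addq /oppq /scaleq /mulq /conjq /=; congr Quat; ring.

Lemma addqA : associative addq. Proof. quat_ring. Qed.
Lemma addqC : commutative addq. Proof. quat_ring. Qed.
Lemma add0q : left_id (Quat 0 0 0 0) addq. Proof. quat_ring. Qed.
Lemma addNq : left_inverse (Quat 0 0 0 0) oppq addq. Proof. quat_ring. Qed.
HB.instance Definition _ := GRing.isZmodule.Build quat addqA addqC add0q addNq.

Lemma mulqA : associative mulq. Proof. quat_ring. Qed.
Lemma mul1q : left_id (Quat 1 0 0 0) mulq. Proof. quat_ring. Qed.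
Lemma mulq1 : right_id (Quat 1 0 0 0) mulq. Proof. quat_ring. Qed.
Lemma mulqDl : left_distributive mulq addq. Proof. quat_ring. Qed.
Lemma mulqDr : right_distributive mulq addq. Proof. quat_ring. Qed.
Lemma oneq_neq0 : Quat 1 0 0 0 != 0. Proof. by []. Qed.
HB.instance Definition _ := GRing.Zmodule_isNzRing.Build quat
  mulqA mul1q mulq1 mulqDl mulqDr oneq_neq0.

Lemma scaleqA a b x : scaleq a (scaleq b x) = scaleq (a * b) x.
Proof. move: x; quat_ring. Qed.
Lemma scale1q : left_id 1 scaleq. Proof. quat_ring. Qed.
Lemma scaleqDr : right_distributive scaleq addq.
Proof. move=> a; quat_ring. Qed.
Lemma scaleqDl x : {morph scaleq^~ x : a b / a + b >-> addq a b}.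
Proof. move: x; case=> ? ? ? ? a b /=; rewrite /scaleq /addq /=; congr Quat; ring. Qed.
HB.instance Definition _ := GRing.Zmodule_isLmodule.Build rat quat
  scaleqA scale1q scaleqDr scaleqDl.

Lemma normq_eq0 x : (normq x == 0) = (x == 0).
Proof.
apply/eqP/eqP => [|->]; last by rewrite /normq !expr0n.
case: x => a b c d; rewrite /normq /= => h.
have [] : [/\ a ^+ 2 = 0, b ^+ 2 = 0, c ^+ 2 = 0 & d ^+ 2 = 0].
  have := sqr_ge0 a; have := sqr_ge0 b; have := sqr_ge0 c; have := sqr_ge0 d.
  by move=> *; split; lra.
by do 4![move/eqP; rewrite expf_eq0 /= => /eqP ->].
Qed.

Lemma mulVq : {in [pred x : quat | x != 0], left_inverse 1 invq *%R}.
Proof.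
move=> x; rewrite inE -normq_eq0; move: x; case=> a b c d.
rewrite /invq /scaleq /normq /= => h.
have E : forall x y, x * y = mulq x y by [].
have E1 : 1 = Quat 1 0 0 0 by [].
by rewrite E E1 /mulq /=; congr Quat; field.
Qed.

Lemma mulqV : {in [pred x : quat | x != 0], right_inverse 1 invq *%R}.
Proof.
move=> x; rewrite inE -normq_eq0; move: x; case=> a b c d.
rewrite /invq /scaleq /normq /= => h.
have E : forall x y, x * y = mulq x y by [].
have E1 : 1 = Quat 1 0 0 0 by [].
by rewrite E E1 /mulq /=; congr Quat; field.
Qed.

Lemma unitqP (x y : quat) : y * x = 1 /\ x * y = 1 -> x != 0.
Proof.
by case=> + _; apply: contra_eqN => /eqP ->; rewrite mulr0 eq_sym oner_neq0.
Qed.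

Lemma invq_out : {in [predC [pred x : quat | x != 0]], invq =1 id}.
Proof.
move=> x; rewrite !inE negbK => /eqP ->.
by rewrite /invq /scaleq /= !mulr0.
Qed.

HB.instance Definition _ := GRing.NzRing_hasMulInverse.Build quat
  mulVq mulqV unitqP invq_out.

Definition qi := Quat 0 1 0 0.
Definition qj := Quat 0 0 1 0.

(* [Tr x] and [Nm x] are elements of D_alg lying in its centre Q. *)
Definition Tr (x : quat) : quat := x + conjq x.
Definition Nm (x : quat) : quat := x * conjq x.

Definition qw : quat := 2^-1 *: (1 + qi + qj + qi * qj).
Definition Hurwitz : set quat := [set x | exists a b c d : int,
  x = 1 *~ a + qi *~ b + qj *~ c + qw *~ d].
Definition Hurwitz_units : set quat := [set x | Hurwitz x /\
  exists y, [/\ Hurwitz y, x * y = 1 & y * x = 1]].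

Definition bV (k : 'I_3) : quat :=
  [:: - qi + qj + qi * qj; qi - qj + qi * qj; qi + qj - qi * qj]`_k.
Definition vecV (x : 'rV[rat]_3) : quat := \sum_k x 0 k *: bV k.
(* On V = {Tr = 0} this is the inverse of [vecV]. *)
Definition coordV (q : quat) : 'rV[rat]_3 :=
  \row_k [:: (q2 q + q3 q) / 2; (q1 q + q3 q) / 2; (q1 q + q2 q) / 2]`_k.


Lemma vecVE x : vecV x = Quat 0 (- x 0 0 + x 0 1 + x 0 2%:R)
   (x 0 0 - x 0 1 + x 0 2%:R) (x 0 0 + x 0 1 - x 0 2%:R).
Proof.
rewrite /vecV !big_ord_recl big_ord0.
have -> : lift ord0 ord0 = 1 :> 'I_3 by apply/val_inj.
have -> : lift ord0 (lift ord0 ord0) = 2%:R :> 'I_3 by apply/val_inj.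
have E : forall x y, x * y = mulq x y by [].
have E0 : forall x y, x + y = addq x y by [].
have E1 : forall x, - x = oppq x by [].
have E2 : forall a x, a *: x = scaleq a x by [].
rewrite /bV /= !E !E0 !E1 !E2 /qi /qj /mulq /addq /oppq /scaleq /=.
congr Quat; ring.
Qed.

Lemma Tr_eq0 q : (Tr q == 0) = (q0 q == 0).
Proof.
apply/eqP/eqP => [[] h _ _ _|h]; first by lra.
rewrite /Tr (_ : forall x y, x + y = addq x y) //.
by case: q h => a b c d /= ->; rewrite /addq /= !subrr.
Qed.

Lemma Tr_vecV x : Tr (vecV x) = 0.
Proof. by apply/eqP; rewrite Tr_eq0 vecVE. Qed.

Lemma vecVK : cancel vecV coordV.
Proof.
move=> x; apply/rowP => k; rewrite vecVE mxE /=.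
case: k => -[|[|[|//]]] h /=.
- by rewrite (_ : Ordinal h = 0); [field|apply/val_inj].
- by rewrite (_ : Ordinal h = 1); [field|apply/val_inj].
- by rewrite (_ : Ordinal h = 2%:R); [field|apply/val_inj].
Qed.

Lemma coordVK q : Tr q = 0 -> vecV (coordV q) = q.
Proof.
move=> /eqP; rewrite Tr_eq0 vecVE !mxE /=; case: q => a b c d /= /eqP ->.
by congr Quat; field.
Qed.

(* Only meaningful for [g != 0]; see [conjg_calF]. *)
Definition calF (g : quat) : 'M[rat]_3 :=
  \matrix_(k < 3) coordV (g^-1 * bV k * g).

Lemma conjg_calF g x : g != 0 -> g^-1 * vecV x * g = vecV (x *m calF g).
Proof.
move=> g0.
have vecV_sum y (B : 'I_3 -> 'rV[rat]_3) :
    vecV (\sum_k y k *: B k) = \sum_k y k *: vecV (B k).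
  rewrite /vecV; under [RHS]eq_bigr do rewrite scaler_sumr.
  rewrite exchange_big; apply: eq_bigr => k _.
  by rewrite summxE scaler_suml; apply: eq_bigr => m _; rewrite mxE scalerA.
have mulZ a (y z : quat) : (a *: y) * z = a *: (y * z).
  by apply/eqP; move: y z => [? ? ? ?] [? ? ? ?]; apply/eqP; congr Quat;
     rewrite /=; ring.
have mulZr a (y z : quat) : y * (a *: z) = a *: (y * z).
  by apply/eqP; move: y z => [? ? ? ?] [? ? ? ?]; apply/eqP; congr Quat;
     rewrite /=; ring.
rewrite mulmx_sum_row vecV_sum /vecV mulr_sumr mulr_suml; apply: eq_bigr => k _.
rewrite mulZr mulZ rowK -/(vecV _) coordVK //.
suff -> : Tr (g^-1 * bV k * g) = Tr (bV k).
  have -> : bV k = vecV (delta_mx 0 k); last exact: Tr_vecV.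
  rewrite /vecV (bigD1 k) //= mxE !eqxx scale1r big1 ?addr0 // => m mk.
  by rewrite mxE eqxx (negbTE mk) scale0r.
have TrC y z : Tr (y * z) = Tr (z * y).
  by case: y z => ? ? ? ? [? ? ? ?]; congr Quat; rewrite /=; ring.
by rewrite TrC mulrA mulrV ?mul1r.
Qed.

(* [Gamma] and [Gamma_gamma2] are finite (of cardinality 12) and [cosets_T2]
   below is a singleton, so the [\sum_(_ \in _)] over them, which vanish by
   convention on infinite supports, are genuine finite sums. *)
Definition Gamma : set 'M[rat]_3 := calF @` Hurwitz_units.
Definition gamma2 : 'M[rat]_3 := calF (qi - qj).
Definition Gamma_gamma2 : set 'M[rat]_3 := [set g *m gamma2 | g in Gamma].
Definition frakT2 : set 'M[rat]_3 :=
  calF @` [set y | Hurwitz y /\ Nm y = 2%:R].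

Definition act (g : 'M[rat]_3) (f : {mpoly rat[3]}) : {mpoly rat[3]} :=
  f \mPo [tuple \sum_i g i j *: 'X_i | j < 3].

Definition DeltaQ (f : {mpoly rat[3]}) : {mpoly rat[3]} :=
  let d i j := f^`M(i)^`M(j) in
  2^-1 *: (d 0 0 + d 1 1 + d 2%:R 2%:R + d 0 1 + d 1 2%:R + d 2%:R 0).

(* The space A_l is [dhomog 3 rat l]. *)
Definition harm l : set (dhomog 3 rat l) := [set f | DeltaQ f = 0].
Definition harm_Gamma l : set (dhomog 3 rat l) :=
  [set f | harm f /\ forall g, Gamma g -> act g f = f].

Definition cosets_T2 : set (set 'M[rat]_3) :=
  [set [set h *m g | h in Gamma] | g in frakT2].

(* On Gamma-invariant [f] the representatives chosen by [xget] are
   irrelevant. *)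
Definition T2 (f : {mpoly rat[3]}) : {mpoly rat[3]} :=
  \sum_(C \in cosets_T2) act (invmx (xget 1%:M C)) f.

(* The boolean [s] encodes the sign [(-1) ^+ s]. *)
Definition harm_Gamma_sgn l (s : bool) : set (dhomog 3 rat l) :=
  [set f | harm_Gamma f /\ T2 f = ((-1) ^+ s * (-1) ^+ l) *: (f : {mpoly rat[3]})].

Definition Ave (f : {mpoly rat[3]}) : {mpoly rat[3]} :=
  \sum_(g \in Gamma) act g f.
Definition Ave_sgn l (s : bool) (f : {mpoly rat[3]}) : {mpoly rat[3]} :=
  Ave f + ((-1) ^+ s * (-1) ^+ l) *: \sum_(g \in Gamma_gamma2) act g f.

(* Degrees are integers so that degree [l - 2] makes sense for [l < 2]. *)
Definition mon (k : int) := {m : 'X_{1..3} | (mdeg m)%:Z == k}.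
Definition dimA (k : int) : nat :=
  if k is Posz n then ((n.+1 * n.+2) %/ 2)%N else 0%N.

(* An ordering of the monomials of degree [k] is a bijection [e]. *)
Definition mx_of (k k' : int) (e : 'I_(dimA k) -> mon k)
    (e' : 'I_(dimA k') -> mon k') (phi : {mpoly rat[3]} -> {mpoly rat[3]}) :
    'M[rat]_(dimA k', dimA k) :=
  \matrix_(i, j) (phi 'X_[val (e j)])@_(val (e' i)).

Lemma mon_homog (l : nat) (m : mon l) : ('X_[val m] : {mpoly rat[3]}) \is l.-homog.
Proof. by rewrite dhomogX; case: m => m /= /eqP[] ->. Qed.

Definition coords (l : nat) (e : 'I_(dimA l) -> mon l) (f : dhomog 3 rat l) :
  'cV[rat]_(dimA l) := \col_i (f : {mpoly rat[3]})@_(val (e i)).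
Definition uncoords (l : nat) (e : 'I_(dimA l) -> mon l)
  (z : 'cV[rat]_(dimA l)) : dhomog 3 rat l :=
  \sum_i z i 0 *: DHomog (mon_homog (e i)).

Lemma uncoordsE (l : nat) (e : 'I_(dimA l) -> mon l) z :
  uncoords e z = \sum_i z i 0 *: 'X_[val (e i)] :> {mpoly rat[3]}.
Proof.
by rewrite /uncoords linear_sum; apply: eq_bigr => i _; rewrite linearZ.
Qed.

Lemma coordsK (l : nat) (e : 'I_(dimA l) -> mon l) :
  bijective e -> cancel (coords e) (uncoords e).
Proof.
move=> [e' eK e'K] f; apply/val_inj; rewrite /= uncoordsE; apply/mpolyP => m.
rewrite linear_sum /=; under eq_bigr do rewrite mxE linearZ /= mcoeffX.
have [hm|hm] := boolP ((mdeg m)%:Z == l%:Z).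
  pose i0 := e' (exist _ m hm); have ei0 : val (e i0) = m by rewrite e'K.
  rewrite (bigD1 i0) //= ei0 eqxx mulr1 big1 ?addr0 // => i ii0.
  case: eqP => [h|]; last by rewrite mulr0.
  by case/eqP: ii0; apply: (can_inj eK); apply/val_inj; rewrite ei0; exact: h.
rewrite big1 => [|i _]; last first.
  case: eqP => [h|]; last by rewrite mulr0.
  by case/negP: hm; move: (valP (e i)); rewrite /= -h.
by rewrite (dhomog_nemf_coeff (mf := mdeg) (d := l)) //; case: f.
Qed.

Lemma uncoordsK (l : nat) (e : 'I_(dimA l) -> mon l) :
  bijective e -> cancel (uncoords e) (coords e).
Proof.
move=> [e' eK e'K] z; apply/colP => i; rewrite mxE uncoordsE.
rewrite linear_sum /=; under eq_bigr do rewrite linearZ /= mcoeffX.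
rewrite (bigD1 i) //= eqxx mulr1 big1 ?addr0 // => j ji.
case: eqP => [h|]; last by rewrite mulr0.
by case/eqP: ji; apply: (can_inj eK); apply/val_inj.
Qed.

Definition colspace m n (A : 'M[rat]_(m, n)) : {vspace 'cV[rat]_m} :=
  limg (linfun (mulmx A : 'cV[rat]_n -> 'cV[rat]_m)).
Definition nullspace m n (A : 'M[rat]_(m, n)) : {vspace 'cV[rat]_n} :=
  lker (linfun (mulmx A : 'cV[rat]_n -> 'cV[rat]_m)).

Definition column_basis m n r (A : 'M[rat]_(m, n)) (B : 'M[rat]_(m, r)) :=
  (exists c : 'I_r -> 'I_n, B = colsub c A) /\
  basis_of (colspace A) [seq col k B | k <- enum 'I_r].

(* [P] is a linear subspace with basis [X]. *)
Definition is_basis (vT : vectType rat) (P : set vT) (X : seq vT) :=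
  free X /\ forall f, P f <-> f \in <<X>>%VS.

(* Main.v *)
From HB Require Import structures.
Require Import Defs.
From mathcomp Require Import all_boot all_order all_algebra.
From mathcomp Require Import mpoly.
From mathcomp Require Import boolp classical_sets.
From mathcomp Require Import functions cardinality fsbigop.
From mathcomp Require Import zify ring.

(* [Ave] and [Ave_sgn] are, up to the nonzero scalars |Gamma| and 2|Gamma|,
   projections of A_l onto the Gamma-invariants, respectively onto those
   invariants on which gamma2 acts by the scalar [(-1) ^+ s * (-1) ^+ l].  Since
   every element of norm 2 of O is a unit times i - j, there is a single coset
   in Gamma \ T_2, and T_2 acts on invariants as gamma2, an involution
   normalising Gamma.  So the column space of the averaging matrix is the
   relevant space of invariants, B parametrises it injectively, and D B z = 0
   cuts out the harmonic ones. *)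

(* [Defs] is imported again because rat.v also defines [mulq], [invq], etc. *)
Import Defs Order.TTheory GRing.Theory Num.Theory.
Local Open Scope ring_scope.

(** * Norm, integrality and units in the Hurwitz order *)

Lemma quat_mulE (x y : quat) : x * y = mulq x y. Proof. by []. Qed.
Lemma quat_oneE : 1 = Quat 1 0 0 0. Proof. by []. Qed.
Lemma quat_invE (x : quat) : x != 0 -> x^-1 = invq x. Proof. by []. Qed.

Lemma normqM x y : normq (x * y) = normq x * normq y.
Proof. by case: x y => ? ? ? ? [? ? ? ?]; rewrite quat_mulE /normq /=; ring. Qed.

Lemma mulq_conj x : x * conjq x = Quat (normq x) 0 0 0.
Proof. by case: x => ? ? ? ?; rewrite quat_mulE /mulq /normq /=; congr Quat; ring. Qed.

Lemma conj_mulq x : conjq x * x = Quat (normq x) 0 0 0.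
Proof. by case: x => ? ? ? ?; rewrite quat_mulE /mulq /normq /=; congr Quat; ring. Qed.

(* The element [a + b i + c j + d w]. *)
Definition hurwitz_quat (a b c d : int) : quat :=
  Quat (a%:~R + d%:~R / 2) (b%:~R + d%:~R / 2) (c%:~R + d%:~R / 2) (d%:~R / 2).

Lemma HurwitzP x : Hurwitz x <-> exists a b c d, x = hurwitz_quat a b c d.
Proof.
have mulz (y : quat) n : y *~ n = scaleq n%:~R y.
  by rewrite -scaler_int.
have E a b c d : 1 *~ a + qi *~ b + qj *~ c + qw *~ d = hurwitz_quat a b c d.
  rewrite !mulz /qw quat_mulE /mulq /= quat_oneE.
  rewrite /hurwitz_quat.
  rewrite (_ : forall y z, y + z = addq y z) // (_ : forall r y, r *: y = scaleq r y) //.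
  by rewrite /addq /scaleq /=; congr Quat; field.
split=> -[a [b [c [d ->]]]]; exists a, b, c, d; rewrite E //.
Qed.

(** The norm form in the basis 1, i, j, w: the four terms [d ^+ 2 / 4] add up to [d ^+ 2], so its
    values are integers. *)
Definition hurwitz_norm (a b c d : int) : int :=
  a ^+ 2 + b ^+ 2 + c ^+ 2 + d ^+ 2 + (a + b + c) * d.

Lemma normq_hurwitz a b c d :
  normq (hurwitz_quat a b c d) = (hurwitz_norm a b c d)%:~R.
Proof.
by rewrite /normq /hurwitz_norm /= !(rmorphD, rmorphM, rmorphXn) /=; field.
Qed.

Lemma HurwitzM x y : Hurwitz x -> Hurwitz y -> Hurwitz (x * y).
Proof.
move=> /HurwitzP [a [b [c [d ->]]]] /HurwitzP [a' [b' [c' [d' ->]]]].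
apply/HurwitzP.
(* The w-coordinate of the product is twice its ij-coordinate; subtracting the ij-coordinate from
   the first three coordinates gives the other witnesses. *)
exists (a * a' - b * b' - c * c' - b * c' + c * b' - b * d' - d * d' - d * c').
exists (a * b' + b * a' - b * c' + c * b' + d * b' + c * d' - d * c').
exists (a * c' + c * a' - b * c' + c * b' - b * d' + d * b' + c * d').
exists (a * d' + d * a' + b * c' *+ 2 - c * b' *+ 2
        + b * d' - d * b' - c * d' + d * c' + d * d').
rewrite quat_mulE /mulq /hurwitz_quat /=.
by congr Quat; rewrite !(rmorphD, rmorphB, rmorphN, rmorphMn, rmorphM) /=; field.
Qed.

Lemma Hurwitz_conj x : Hurwitz x -> Hurwitz (conjq x).
Proof.
move=> /HurwitzP [a [b [c [d ->]]]]; apply/HurwitzP.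
(* The conjugate of w is 1 - w. *)
exists (a + d), (- b), (- c), (- d); rewrite /conjq /hurwitz_quat /=.
by congr Quat; rewrite ?(rmorphD, rmorphN) /=; field.
Qed.

(** Norms on the order are nonnegative integers and multiply, so two mutually inverse elements both
    have norm 1; conversely the conjugate is the inverse. *)
Lemma Hurwitz_unitsE x : Hurwitz_units x <-> Hurwitz x /\ normq x = 1.
Proof.
split=> [[Hx [y [Hy xy _]]]|[Hx nx]]; split=> //; last first.
  exists (conjq x); split; first exact: Hurwitz_conj.
  - by rewrite mulq_conj nx.
  - by rewrite conj_mulq nx.
have : normq x * normq y = 1 by rewrite -normqM xy.
have : 0 <= normq x by rewrite /normq !addr_ge0 ?sqr_ge0.
have : 0 <= normq y by rewrite /normq !addr_ge0 ?sqr_ge0.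
case/HurwitzP: Hx => [a [b [c [d ->]]]]; case/HurwitzP: Hy => [a' [b' [c' [d' ->]]]].
rewrite !normq_hurwitz -intrM !ler0z => h1 h2 /eqP.
rewrite -[1]/(1%:~R) eqr_int => /eqP h3; congr (_%:~R).
by case: (hurwitz_norm a b c d) (hurwitz_norm a' b' c' d') h1 h2 h3
  => m [] n // _ _ [] /eqP; rewrite muln_eq1 => /andP [/eqP -> _].
Qed.

Lemma Hurwitz_units_neq0 x : Hurwitz_units x -> x != 0.
Proof. by move=> /Hurwitz_unitsE [_ nx]; rewrite -normq_eq0 nx oner_eq0. Qed.

Lemma Hurwitz_unitsM x y :
  Hurwitz_units x -> Hurwitz_units y -> Hurwitz_units (x * y).
Proof.
move=> /Hurwitz_unitsE [Hx nx] /Hurwitz_unitsE [Hy ny]; apply/Hurwitz_unitsE.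
by split; [exact: HurwitzM | rewrite normqM nx ny mulr1].
Qed.

Lemma Hurwitz_units1 : Hurwitz_units 1.
Proof.
apply/Hurwitz_unitsE; split; last by rewrite /normq /=; ring.
by apply/HurwitzP; exists 1, 0, 0, 0; rewrite /hurwitz_quat quat_oneE; congr Quat; ring.
Qed.

Lemma Hurwitz_units_conj x : Hurwitz_units x -> Hurwitz_units (conjq x).
Proof.
move=> /Hurwitz_unitsE [Hx nx]; apply/Hurwitz_unitsE; split.
  exact: Hurwitz_conj.
by rewrite -nx /normq /= !sqrrN.
Qed.

(** Four times the norm is a sum of four integer squares, which for norm 1 confines [a], [b], [c],
    [d] to the interval from -2 to 2. *)
Lemma finite_Hurwitz_units : finite_set Hurwitz_units.
Proof.
(* The shift by 2 makes ['I_5] enumerate the integers from -2 to 2. *)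
pose f (t : 'I_5 * 'I_5 * 'I_5 * 'I_5) := let: (a, b, c, d) := t in
  hurwitz_quat (a%:Z - 2) (b%:Z - 2) (c%:Z - 2) (d%:Z - 2).
apply: (@sub_finite_set _ _ (f @` [set: _])%classic); last first.
  exact/finite_image/finite_finset.
move=> x /Hurwitz_unitsE [/HurwitzP [a [b [c [d ->]]]]].
rewrite normq_hurwitz => /eqP; rewrite -[1]/(1%:~R) eqr_int => /eqP nx.
have nx4 : (2 * a + d) ^+ 2 + (2 * b + d) ^+ 2 + (2 * c + d) ^+ 2 + d ^+ 2 = 4.
  by transitivity (4 * hurwitz_norm a b c d); [rewrite /hurwitz_norm; ring | rewrite nx].
have sq_le (u v : int) : 0 <= v -> u ^+ 2 + v = 4 -> -2 <= u <= 2.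
  by move=> v0 uv; apply/andP; split; nia.
have [S1 S2 S3 S4] : [/\ -2 <= 2 * a + d <= 2, -2 <= 2 * b + d <= 2,
    -2 <= 2 * c + d <= 2 & -2 <= d <= 2].
  have := sqr_ge0 (2 * a + d); have := sqr_ge0 (2 * b + d).
  have := sqr_ge0 (2 * c + d); have := sqr_ge0 d.
  move: nx4; set A := (_ + d) ^+ 2; set B := (_ + d) ^+ 2.
  set C := (_ + d) ^+ 2; set DD := d ^+ 2 => nx4 *; split.
  - by apply: (sq_le _ (B + C + DD)); lia.
  - by apply: (sq_le _ (A + C + DD)); lia.
  - by apply: (sq_le _ (A + B + DD)); lia.
  - by apply: (sq_le _ (A + B + C)); lia.
have ord5 (u : int) : -2 <= u <= 2 -> exists i : 'I_5, u = i%:Z - 2.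
  move=> hu; have h5 : (absz (u + 2)%R < 5)%N by lia.
  by exists (Ordinal h5); rewrite /=; lia.
have [i ->] : exists i : 'I_5, a = i%:Z - 2 by apply: ord5; lia.
have [j ->] : exists i : 'I_5, b = i%:Z - 2 by apply: ord5; lia.
have [k ->] : exists i : 'I_5, c = i%:Z - 2 by apply: ord5; lia.
have [m ->] : exists i : 'I_5, d = i%:Z - 2 by apply: ord5; lia.
by exists (i, j, k, m).
Qed.

(** * Elements of norm 2 *)

Lemma normq_qimj : normq (qi - qj) = 2.
Proof. by rewrite /normq /=; ring. Qed.

Lemma Nm_normq (x : quat) (r : rat) : Nm x = Quat r 0 0 0 <-> normq x = r.
Proof. by rewrite /Nm mulq_conj; split=> [[]|->]. Qed.

(* The norm of [hurwitz_quat a b c d] is [d ^+ 2] plus an even number when [d]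
   is odd, so that norm 2 forces [d] and [a + b + c] to be even. *)
Lemma hurwitz_norm2 a b c d : hurwitz_norm a b c d = 2 ->
  exists k m, d = k * 2 /\ a + b + c = m * 2.
Proof.
have par (u : int) : exists v, u = v * 2 \/ u = v * 2 + 1.
  exists (divz u 2); have := divz_eq u 2.
  by have := modz_ge0 u (isT : 2 != 0 :> int); have := ltz_pmod u (isT : 0 < 2 :> int); lia.
have [a' ea] := par a; have [b' eb] := par b.
have [c' ec] := par c; have [d' ed] := par d.
rewrite /hurwitz_norm => h; case: ed => ed; last first.
  exfalso.
  by case: ea; case: eb; case: ec => *; subst; lia.
exists d'.
by case: ea; case: eb; case: ec => *; subst;
   first [exists (a' + b' + c'); split; lia | exists (a' + b' + c' + 1); split; lia].
Qed.

Lemma invr_qimj : (qi - qj)^-1 = Quat 0 (- 2^-1) 2^-1 0.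
Proof. by rewrite quat_invE // /invq normq_qimj /scaleq /=; congr Quat; ring. Qed.

Lemma normq_invr x : normq x^-1 = (normq x)^-1.
Proof.
have [->|x0] := eqVneq x 0; first by rewrite invr0 /normq /= expr0n /= !addr0 invr0.
have /(congr1 normq) : x^-1 * x = 1 by rewrite mulVr.
rewrite normqM => nx; have n0 : normq x != 0 by rewrite normq_eq0.
apply: (mulIf n0); rewrite nx mulVf // /normq /=; ring.
Qed.

(** The quotient has norm 2/2 = 1, so the point is its integrality, which follows from the parity
    given by [hurwitz_norm2]. *)
Lemma hurwitz_norm2_dvdr y : Hurwitz y -> normq y = 2 ->
  Hurwitz_units (y / (qi - qj)).
Proof.
move=> Hy ny; apply/Hurwitz_unitsE; split; last first.
  by rewrite normqM normq_invr normq_qimj ny mulfV.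
case/HurwitzP: Hy ny => a [b [c [d ->]]].
rewrite normq_hurwitz => /eqP; rewrite -[2]/(2%:~R) eqr_int => /eqP.
move=> /hurwitz_norm2 [k [m [-> abc]]].
have -> : a = m * 2 - b - c by rewrite -abc; ring.
(* Coordinates of y(j - i)/2 in the basis 1, i, j, w, after substituting d = 2k and a = 2m - b -
   c. *)
apply/HurwitzP; exists (- c - k), (- (m + k * 2)), (m - b - c - k), (b + c + k * 2).
rewrite invr_qimj quat_mulE /mulq /hurwitz_quat /=.
by congr Quat; rewrite !(rmorphD, rmorphB, rmorphN, rmorphM) /=; field.
Qed.

Lemma Hurwitz_qimj : Hurwitz (qi - qj).
Proof. by apply/HurwitzP; exists 0, 1, (-1), 0; congr Quat; rewrite /=; field. Qed.

(** * The group Gamma, the involution gamma2 and the coset T_2 *)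

Lemma mulmx_row_inj m n (A B : 'M[rat]_(m, n)) :
  (forall x : 'rV_m, x *m A = x *m B) -> A = B.
Proof. by move=> AB; apply/row_matrixP => i; rewrite !rowE AB. Qed.

Lemma quat_unitE (x : quat) : (x \is a GRing.unit) = (x != 0).
Proof. by []. Qed.

Lemma mulq_neq0 (x y : quat) : x != 0 -> y != 0 -> x * y != 0.
Proof. by rewrite -!normq_eq0 normqM => *; apply: mulf_neq0. Qed.

(** Conjugation by gh is conjugation by g followed by conjugation by h, and on row vectors the
    matrix applied first stands on the left. *)
Lemma calFM g h : g != 0 -> h != 0 -> calF (g * h) = calF g *m calF h.
Proof.
move=> g0 h0; apply: mulmx_row_inj => x; apply: (can_inj vecVK).
rewrite mulmxA -!conjg_calF ?mulq_neq0 // invrM ?quat_unitE //.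
by rewrite !mulrA.
Qed.

(** Scalars are central, so they conjugate trivially. *)
Lemma calF_scalar r : r != 0 -> calF (Quat r 0 0 0) = 1%:M.
Proof.
move=> r0; have x0 : Quat r 0 0 0 != 0 by apply: contraNneq r0 => -[->].
apply: mulmx_row_inj => x; apply: (can_inj vecVK).
rewrite mulmx1 -conjg_calF // -mulrA (_ : vecV x * _ = Quat r 0 0 0 * vecV x).
  by rewrite mulKr.
by case: (vecV x) => *; rewrite !quat_mulE /mulq /=; congr Quat; ring.
Qed.

Lemma finite_Gamma : finite_set Gamma.
Proof. exact/finite_image/finite_Hurwitz_units. Qed.

Lemma Gamma1 : Gamma 1%:M.
Proof.
by exists 1; [exact: Hurwitz_units1 | rewrite quat_oneE calF_scalar ?oner_eq0].
Qed.

Lemma GammaM g h : Gamma g -> Gamma h -> Gamma (g *m h).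
Proof.
move=> [x Hx <-] [y Hy <-]; exists (x * y); first exact: Hurwitz_unitsM.
by rewrite calFM //; apply: Hurwitz_units_neq0.
Qed.

Lemma GammaV g : Gamma g -> exists2 h, Gamma h & g *m h = 1%:M.
Proof.
move=> [x Hx <-]; have Hx' := Hurwitz_units_conj x Hx.
exists (calF (conjq x)); first by exists (conjq x).
rewrite -calFM; try exact: Hurwitz_units_neq0.
have [_ nx] := (Hurwitz_unitsE x).1 Hx.
by rewrite mulq_conj nx calF_scalar.
Qed.

(** The square of i - j is the scalar -2. *)
Lemma gamma2K : gamma2 *m gamma2 = 1%:M.
Proof.
by rewrite -calFM // (_ : _ * _ = Quat (-2) 0 0 0) ?calF_scalar.
Qed.

(** For a unit u the element (i - j)u has norm 2, hence equals v(i - j) with v a unit; conjugation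
    by [gamma2] then sends [calF u] to [calF v]. *)
Lemma gamma2_Gamma g : Gamma g -> Gamma (gamma2 *m g *m gamma2).
Proof.
move=> [u Hu <-]; have u0 := Hurwitz_units_neq0 u Hu.
have [HHu nu] := (Hurwitz_unitsE u).1 Hu.
pose y := (qi - qj) * u; have yE : y = y / (qi - qj) * (qi - qj) by rewrite divrK.
have Hv : Hurwitz_units (y / (qi - qj)).
  apply: hurwitz_norm2_dvdr; first exact: HurwitzM Hurwitz_qimj HHu.
  by rewrite normqM normq_qimj nu mulr1.
exists (y / (qi - qj)) => //.
rewrite -calFM // -/y [in RHS]yE [in RHS]calFM // ?Hurwitz_units_neq0 //.
by rewrite -mulmxA gamma2K mulmx1.
Qed.

Lemma frakT2E : frakT2 = Gamma_gamma2.
Proof.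
apply/seteqP; split=> [_ [y [Hy /Nm_normq ny] <-]|_ [_ [u Hu <-] <-]].
  have Hu := hurwitz_norm2_dvdr y Hy ny.
  exists (calF (y / (qi - qj))); first by exists (y / (qi - qj)).
  by rewrite /gamma2 -calFM // ?divrK // Hurwitz_units_neq0.
have [HHu nu] := (Hurwitz_unitsE u).1 Hu.
exists (u * (qi - qj)); last by rewrite calFM // Hurwitz_units_neq0.
split; first exact: HurwitzM HHu Hurwitz_qimj.
by apply/Nm_normq; rewrite normqM normq_qimj nu mul1r.
Qed.

Lemma cosets_T2E : cosets_T2 = [set Gamma_gamma2]%classic.
Proof.
rewrite /cosets_T2 frakT2E; apply/seteqP; split=> [_ [_ [g Gg <-] <-]|_ ->] /=.
  apply/seteqP; split=> [_ [h Gh <-]|_ [h Gh <-]].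
    by exists (h *m g); [exact: GammaM | rewrite mulmxA].
  have [g' Gg' gg'] := GammaV g Gg; exists (h *m g'); first exact: GammaM.
  by rewrite -!mulmxA [g' *m _]mulmxA (mulmx1C gg') mul1mx.
exists (1%:M *m gamma2); first by exists 1%:M => //; exact: Gamma1.
by rewrite mul1mx.
Qed.

(** * Linear substitutions and the Laplacian on polynomials *)

HB.instance Definition _ (g : 'M[rat]_3) := GRing.Linear.copy (act g)
  (comp_mpoly [tuple \sum_i g i j *: 'X_i | j < 3]).

Lemma act1 f : act 1%:M f = f.
Proof.
rewrite -[RHS]comp_mpoly_id /act; congr comp_mpoly.
apply: eq_from_tnth => j; rewrite !tnth_mktuple (bigD1 j) //= mxE eqxx scale1r.
by rewrite big1 ?addr0 // => i ij; rewrite mxE (negbTE ij) scale0r.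
Qed.

(** Both sides are f(xgh). By linearity and multiplicativity the check reduces to the variables,
    where it is the formula for a matrix product. *)
Lemma actM g h f : act g (act h f) = act (g *m h) f.
Proof.
rewrite [f]mpolyE (linear_sum (act h)) (linear_sum (act g)) (linear_sum (act (g *m h))).
apply: eq_bigr => m _; rewrite !linearZ /=; congr (_ *: _).
rewrite /act !comp_mpolyX rmorph_prod; apply: eq_bigr => j _.
rewrite rmorphXn; congr (_ ^+ _); rewrite !tnth_mktuple /= linear_sum /=.
under eq_bigr do rewrite comp_mpolyZ comp_mpolyXU -tnth_nth tnth_mktuple scaler_sumr.
rewrite exchange_big; apply: eq_bigr => i _; rewrite mxE scaler_suml.
by apply: eq_bigr => k _; rewrite scalerA mulrC.
Qed.

Lemma act_homog l g (f : {mpoly rat[3]}) : f \is l.-homog -> act g f \is l.-homog.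
Proof.
move=> hf; rewrite [f]mpolyE linear_sum big_seq.
apply: rpred_sum => m mf; rewrite linearZ /=; apply: rpredZ.
have <- : mdeg m = l by apply: dhomog_mf mf.
rewrite /act comp_mpolyX mdegE.
elim/big_ind2: _ => [|p a q b hp hq|j _]; first exact: dhomog1.
  exact: dhomogM.
elim: (m j) => [|n IHn]; first exact: dhomog1.
rewrite exprS -(add1n n); apply: dhomogM => //; rewrite tnth_mktuple.
by apply: rpred_sum => k _; apply: rpredZ; rewrite dhomogX /= mdeg1.
Qed.

Lemma DeltaQ_is_linear : linear DeltaQ.
Proof.
move=> a f g; apply/mpolyP => m; rewrite /DeltaQ !linearP /=.
by rewrite !(mcoeffD, mcoeffZ); ring.
Qed.

HB.instance Definition _ := GRing.isLinear.Build rat {mpoly rat[3]} {mpoly rat[3]} _ DeltaQ DeltaQ_is_linear.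

(** Second derivatives lower the degree by two. With the degree taken in [int], the case l < 2 is
    covered: every coefficient then vanishes. *)
Lemma DeltaQ_coef f m l : f \is l.-homog -> (mdeg m)%:Z != l%:Z - 2 ->
  (DeltaQ f)@_m = 0.
Proof.
move=> hf hm.
have d0 i j : (f^`M(i)^`M(j))@_m = 0.
  rewrite !mcoeff_deriv (dhomog_nemf_coeff hf) ?mul0rn //.
  by rewrite /= !mdegD !mdeg1; lia.
by rewrite /DeltaQ mcoeffZ !mcoeffD !d0 !addr0 mulr0.
Qed.

(** * Averaging over Gamma and over its coset *)

Lemma big_Gamma_invl (F : 'M[rat]_3 -> {mpoly rat[3]}) h : Gamma h ->
  \sum_(g \in Gamma) F (h *m g) = \sum_(g \in Gamma) F g.
Proof.
move=> Gh; have [h' Gh' hh'] := GammaV h Gh; have h'h := mulmx1C hh'.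
rewrite [RHS](@reindex_fsbig _ _ _ _ _ (fun g => h *m g) Gamma) //.
split=> [g Gg|g g' _ _ /= /(congr1 (mulmx h'))|g Gg].
- exact: GammaM.
- by rewrite !mulmxA h'h !mul1mx.
- by exists (h' *m g); [exact: GammaM | rewrite mulmxA hh' mul1mx].
Qed.

Lemma big_Gamma_conj (F : 'M[rat]_3 -> {mpoly rat[3]}) :
  \sum_(g \in Gamma) F (gamma2 *m g *m gamma2) = \sum_(g \in Gamma) F g.
Proof.
have conjK g : gamma2 *m (gamma2 *m g *m gamma2) *m gamma2 = g.
  by rewrite -!mulmxA gamma2K mulmx1 mulmxA gamma2K mul1mx.
rewrite [RHS](@reindex_fsbig _ _ _ _ _ (fun g => gamma2 *m g *m gamma2) Gamma) //.
split=> [g Gg|g g' _ _ /= E|g Gg].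
- exact: gamma2_Gamma.
- by rewrite -[g]conjK E conjK.
- by exists (gamma2 *m g *m gamma2); [exact: gamma2_Gamma | rewrite conjK].
Qed.

Lemma big_Gamma_gamma2 (F : 'M[rat]_3 -> {mpoly rat[3]}) :
  \sum_(g \in Gamma_gamma2) F g = \sum_(g \in Gamma) F (g *m gamma2).
Proof.
rewrite (@reindex_fsbig _ _ _ _ _ (fun g => g *m gamma2) Gamma) //.
split=> [g Gg|g g' _ _ /= /(congr1 (mulmx^~ gamma2))|_ [g Gg <-]].
- by exists g.
- by rewrite -!mulmxA gamma2K !mulmx1.
- by exists g.
Qed.

Lemma AveE f : Ave f = \sum_(g <- finmap.enum_fset (fset_set Gamma)) act g f.
Proof. by rewrite /Ave fsbig_finite //; exact: finite_Gamma. Qed.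

Lemma Ave_is_linear : linear Ave.
Proof.
move=> a f g; rewrite !AveE scaler_sumr -big_split; apply: eq_bigr => h _.
by rewrite linearP.
Qed.

HB.instance Definition _ := GRing.isLinear.Build rat {mpoly rat[3]} {mpoly rat[3]} _ Ave Ave_is_linear.

Lemma Ave_homog l f : f \is l.-homog -> Ave f \is l.-homog.
Proof. by move=> hf; rewrite AveE rpred_sum // => g _; apply: act_homog. Qed.

Lemma act_Ave g f : Gamma g -> act g (Ave f) = Ave f.
Proof.
move=> Gg; rewrite -[RHS](big_Gamma_invl (fun h => act h f) g) //.
rewrite AveE linear_sum fsbig_finite; last exact: finite_Gamma.
by apply: eq_bigr => h _; rewrite /= actM.
Qed.

(** The scalar is the cardinality of Gamma, nonzero because Gamma contains the identity; dividing by
    it exhibits an invariant as an average. *)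
Lemma Ave_inv f : (forall g, Gamma g -> act g f = f) ->
  exists2 n : nat, n != 0%N & Ave f = n%:R *: f.
Proof.
move=> inv; exists (size (finmap.enum_fset (fset_set Gamma))).
  rewrite -lt0n -has_predT; apply/hasP; exists 1%:M => //.
  by rewrite in_fset_set ?inE; [exact: Gamma1 | exact: finite_Gamma].
rewrite AveE big_seq (eq_bigr (fun=> f)) => [|g]; last first.
  by rewrite in_fset_set ?inE; [exact: inv | exact: finite_Gamma].
rewrite -big_seq big_const_seq count_predT iter_addr_0 scaler_nat //.
Qed.

(** Reindexing the sum by conjugation with [gamma2] moves [gamma2] past each element of Gamma. *)
Lemma act_gamma2_Ave f : act gamma2 (Ave f) = Ave (act gamma2 f).
Proof.
rewrite AveE linear_sum -fsbig_finite; last exact: finite_Gamma.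
rewrite -big_Gamma_conj; apply: eq_fsbigr => g _.
by rewrite /= !actM !mulmxA gamma2K mul1mx.
Qed.

Lemma Ave_sgnE l (s : bool) f :
  Ave_sgn l s f = Ave f + ((-1) ^+ s * (-1) ^+ l) *: Ave (act gamma2 f).
Proof.
rewrite /Ave_sgn big_Gamma_gamma2; congr (_ + _ *: _).
by apply: eq_fsbigr => g _; rewrite actM.
Qed.

Lemma Ave_sgn_is_linear l s : linear (Ave_sgn l s).
Proof.
move=> a f g; rewrite !Ave_sgnE !linearP /=.
by apply/mpolyP => m; rewrite !(mcoeffD, mcoeffZ); ring.
Qed.

HB.instance Definition _ l s := GRing.isLinear.Build rat {mpoly rat[3]} {mpoly rat[3]} _
  (Ave_sgn l s) (Ave_sgn_is_linear l s).

Lemma Ave_sgn_homog l s f : f \is l.-homog -> Ave_sgn l s f \is l.-homog.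
Proof.
move=> hf; rewrite Ave_sgnE; apply: rpredD; first exact: Ave_homog.
by apply: rpredZ; apply: Ave_homog; apply: act_homog.
Qed.

(** * The operator T_2 and the images of the averaging maps *)

Lemma T2_inv f : (forall g, Gamma g -> act g f = f) -> T2 f = act gamma2 f.
Proof.
move=> inv; rewrite /T2 cosets_T2E fsbig_set1.
have [h Gh <-] : Gamma_gamma2 (xget 1%:M Gamma_gamma2).
  by apply: (@xgetI _ _ _ gamma2); exists 1%:M; [exact: Gamma1 | rewrite mul1mx].
have [h' Gh' hh'] := GammaV h Gh.
(* Whichever representative [h *m gamma2] is chosen, its inverse is [gamma2] times an element of
   Gamma, and the latter fixes f. *)
have -> : invmx (h *m gamma2) = gamma2 *m h'.
  have E : (h *m gamma2) *m (gamma2 *m h') = 1%:M.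
    by rewrite mulmxA -[h *m _ *m _]mulmxA gamma2K mulmx1.
  by rewrite -[LHS]mulmx1 -E mulKmx //; case: (mulmx1_unit E).
by rewrite -actM inv.
Qed.

Lemma imAve l (f : dhomog 3 rat l) : (forall g, Gamma g -> act g f = f) <->
  exists h : dhomog 3 rat l, f = Ave h :> {mpoly rat[3]}.
Proof.
split=> [inv|[h ->] g Gg]; last exact: act_Ave.
have [n n0 fE] := Ave_inv f inv.
exists (n%:R^-1 *: f); rewrite /= linearZ /= fE scalerA mulVf ?scale1r //.
by rewrite pnatr_eq0.
Qed.

Lemma imAve_sgn l (s : bool) (f : dhomog 3 rat l) :
  ((forall g, Gamma g -> act g f = f) /\
   T2 f = ((-1) ^+ s * (-1) ^+ l) *: (f : {mpoly rat[3]})) <->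
  exists h : dhomog 3 rat l, f = Ave_sgn l s h :> {mpoly rat[3]}.
Proof.
set eps := (_ * _ : rat).
have eps2 : eps * eps = 1 by rewrite /eps mulrACA -!expr2 !sqrr_sign mulr1.
split=> [[inv T2f]|[h ->]].
  have [n n0 fE] := Ave_inv f inv.
  move: T2f; rewrite (T2_inv f) // => actf.
  (* As [gamma2] acts on f by [eps] and [eps * eps = 1], each half of [Ave_sgn] contributes
     [n%:R *: f]. *)
  exists ((2 * n%:R)^-1 *: f); rewrite /= linearZ /= Ave_sgnE actf linearZ /=.
  rewrite -/eps scalerA eps2 scale1r fE -scalerDl scalerA.
  rewrite [X in X *: _](_ : _ = 1) ?scale1r //.
  by have := n0; rewrite -(pnatr_eq0 rat) => n0'; field.
have inv g : Gamma g -> act g (Ave_sgn l s h) = Ave_sgn l s h.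
  by move=> Gg; rewrite Ave_sgnE linearD linearZ /= !act_Ave.
(* The action of [gamma2] swaps the two averages, and since [eps * eps = 1] this swap amounts to
   scaling by [eps]. *)
split=> //; rewrite T2_inv // Ave_sgnE linearD linearZ /= !act_gamma2_Ave.
by rewrite actM gamma2K act1 -/eps scalerDr scalerA eps2 scale1r addrC.
Qed.

(** * Matrices of linear maps in monomial coordinates *)

Lemma uncoords_is_linear (l : nat) (e : 'I_(dimA l) -> mon l) : linear (uncoords e).
Proof.
move=> a y z; rewrite /uncoords scaler_sumr -big_split; apply: eq_bigr => i _.
by rewrite !mxE scalerDl scalerA.
Qed.

HB.instance Definition _ (l : nat) (e : 'I_(dimA l) -> mon l) :=
  GRing.isLinear.Build rat 'cV[rat]_(dimA l) (dhomog 3 rat l) _ (uncoords e)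
    (uncoords_is_linear l e).

Lemma mx_of_coords (l : nat) (k : int) (e : 'I_(dimA l) -> mon l)
    (e' : 'I_(dimA k) -> mon k) (phi : {linear {mpoly rat[3]} -> {mpoly rat[3]}})
    (f : dhomog 3 rat l) : bijective e ->
  mx_of e e' phi *m coords e f = \col_i (phi f)@_(val (e' i)).
Proof.
move=> he; apply/colP => i; rewrite !mxE.
rewrite -[f in RHS](coordsK he) uncoordsE !linear_sum /=.
by apply: eq_bigr => j _; rewrite !mxE !linearZ /= mulrC.
Qed.

Lemma mx_of_coords_homog (l : nat) (e : 'I_(dimA l) -> mon l)
    (phi : {linear {mpoly rat[3]} -> {mpoly rat[3]}}) (f g : dhomog 3 rat l) :
  bijective e -> phi f \is l.-homog ->
  mx_of e e phi *m coords e f = coords e g <->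
    g = phi f :> {mpoly rat[3]}.
Proof.
move=> he hom; have -> : mx_of e e phi *m coords e f = coords e (DHomog hom).
  by rewrite mx_of_coords.
by split=> [/(can_inj (coordsK he)) <-|gE]; last congr coords; apply/val_inj.
Qed.

(** The matrix sees only coefficients in degree l - 2; the remaining ones vanish by
    [DeltaQ_coef]. *)
Lemma mx_of_DeltaQ_eq0 (l : nat) (e : 'I_(dimA l%:Z) -> mon l%:Z)
    (e' : 'I_(dimA (l%:Z - 2)) -> mon (l%:Z - 2)) (f : dhomog 3 rat l) :
  bijective e -> bijective e' ->
  mx_of e e' DeltaQ *m coords e f = 0 <-> DeltaQ f = 0.
Proof.
move=> he [e'' eK e''K]; rewrite mx_of_coords //; split=> [/colP D0|D0]; last first.
  by apply/colP => i; rewrite !mxE /= D0 mcoeff0.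
apply/mpolyP => m; rewrite mcoeff0.
have [hm|hm] := boolP ((mdeg m)%:Z == l%:Z - 2); last first.
  by apply: (DeltaQ_coef _ _ l) => //; apply: dhomog_is_dhomog.
by have := D0 (e'' (exist _ m hm)); rewrite !mxE e''K.
Qed.

(** * Column bases and the transport of bases to harmonic invariants *)

Lemma mulmx_col_sum m n (B : 'M[rat]_(m, n)) (z : 'cV_n) :
  B *m z = \sum_k z k 0 *: col k B.
Proof.
apply/colP => i; rewrite mxE summxE; apply: eq_bigr => k _.
by rewrite !mxE mulrC.
Qed.

Lemma memv_colspace m n (A : 'M[rat]_(m, n)) w :
  reflect (exists z, w = A *m z) (w \in colspace A).
Proof.
apply: (iffP memv_imgP) => [[z _]|[z ->]]; first by rewrite lfunE; exists z.
by exists z; rewrite ?memvf // lfunE.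
Qed.

Lemma memv_nullspace m n (A : 'M[rat]_(m, n)) z :
  (z \in nullspace A) = (A *m z == 0).
Proof. by rewrite memv_ker lfunE. Qed.

Lemma column_basis_image {m n r} {A : 'M[rat]_(m, n)} {B : 'M_(m, r)} {w : 'cV_m} :
  column_basis A B -> (exists z, w = A *m z) <-> (exists z, w = B *m z).
Proof.
move=> [[c ->] /andP [/eqP spanB _]]; rewrite (rwP (memv_colspace _ _ A w)) -spanB.
split=> [wB|[z ->]]; last first.
  rewrite mulmx_col_sum; apply: rpred_sum => k _; apply/rpredZ/memv_span.
  by apply: map_f; rewrite mem_enum.
have {wB} /coord_span wB : w \in <<[tuple col k (colsub c A) | k < r]>>%VS by [].
exists (\col_k coord [tuple col k (colsub c A) | k < r] k w).
rewrite {1}wB mulmx_col_sum; apply: eq_bigr => k _.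
by rewrite mxE -tnth_nth tnth_mktuple.
Qed.

Lemma column_basis_inj {m n r} {A : 'M[rat]_(m, n)} {B : 'M_(m, r)} {z : 'cV_r} :
  column_basis A B -> B *m z = 0 -> z = 0.
Proof.
move=> [_ /andP [_ freeB]]; rewrite mulmx_col_sum => Bz.
have /freeP fB : free [tuple col k B | k < r] by [].
apply/colP => k; rewrite mxE; apply: (fB (fun k => z k 0)).
by rewrite -[RHS]Bz; apply: eq_bigr => i _; rewrite -tnth_nth tnth_mktuple.
Qed.

(** Common form of (i) and (ii), with [phi] the averaging map: z maps to [uncoords e (B *m z)]
    injectively, with image the range of [phi] on A_l, and the null space of [D *m B] corresponds to
    the harmonic elements of that range. *)
Lemma is_basis_harm_image (l : nat) (e : 'I_(dimA l%:Z) -> mon l%:Z)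
    (e' : 'I_(dimA (l%:Z - 2)) -> mon (l%:Z - 2))
    (phi : {linear {mpoly rat[3]} -> {mpoly rat[3]}}) (P : set (dhomog 3 rat l))
    (r : nat) (B : 'M[rat]_(dimA l%:Z, r)) (v : seq 'cV[rat]_r) :
  bijective e -> bijective e' ->
  (forall f : {mpoly rat[3]}, f \is l.-homog -> phi f \is l.-homog) ->
  (forall f, P f <-> @harm l f /\
     exists h : dhomog 3 rat l, f = phi h :> {mpoly rat[3]}) ->
  column_basis (mx_of e e phi) B ->
  basis_of (nullspace (mx_of e e' DeltaQ *m B)) v ->
  is_basis P [seq uncoords e (B *m z) | z <- v].
Proof.
move=> he he' hom PE cB bv.
pose L := linfun (uncoords e \o mulmx B).
have LE z : L z = uncoords e (B *m z) by rewrite lfunE.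
(* The condition under which [L] carries a basis of the null space to a basis of its image; it holds
   because the columns of [B] are free. *)
have kerL : (nullspace (mx_of e e' DeltaQ *m B) :&: lker L)%VS = 0%VS.
  apply/eqP; rewrite -subv0; apply/subvP => z.
  rewrite memv_cap memv0 => /andP [_]; rewrite memv_ker LE => /eqP.
  rewrite -(linear0 (uncoords e)) => /(can_inj (uncoordsK he)).
  by move=> /(column_basis_inj cB) ->.
have := limg_basis_of kerL bv; rewrite (eq_map LE) => /andP [/eqP spanL freeL].
split=> // f; rewrite spanL PE.
have DE z : uncoords e (B *m z) = f ->
    z \in nullspace (mx_of e e' DeltaQ *m B) <-> harm f.
  move=> fE; rewrite memv_nullspace -mulmxA -(rwP eqP).
  by rewrite -[B *m z](uncoordsK he) fE mx_of_DeltaQ_eq0.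
split=> [[hf [h fE]]|/memv_imgP [z zN fE]].
  have [z zE] : exists z, coords e f = B *m z.
    apply/(column_basis_image cB); exists (coords e h).
    by apply/esym/mx_of_coords_homog; rewrite ?hom //; apply: dhomog_is_dhomog.
  have fz : uncoords e (B *m z) = f by rewrite -zE coordsK.
  by apply/memv_imgP; exists z; rewrite ?LE ?fz //; apply/DE.
rewrite LE in fE; split; first by apply/(DE z).
have [y yE] : exists y, B *m z = mx_of e e phi *m y.
  by apply/(column_basis_image cB); exists z.
exists (uncoords e y); apply/(mx_of_coords_homog _ e) => //; first by apply/hom/dhomog_is_dhomog.
by rewrite uncoordsK // -yE fE uncoordsK.
Qed.

Theorem mainTheorem4 (l : nat)
    (e : 'I_(dimA l%:Z) -> mon l%:Z) (e' : 'I_(dimA (l%:Z - 2)) -> mon (l%:Z - 2))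
    (he : bijective e) (he' : bijective e') :
  let D := mx_of e e' DeltaQ in
  [/\ \dim {: dhomog 3 rat l} = dimA l%:Z,
      forall (r : nat) (B : 'M[rat]_(dimA l%:Z, r)) (v : seq 'cV[rat]_r),
        column_basis (mx_of e e Ave) B ->
        basis_of (nullspace (D *m B)) v ->
        is_basis (@harm_Gamma l) [seq uncoords e (B *m z) | z <- v]
    & forall (s : bool) (r : nat) (B : 'M[rat]_(dimA l%:Z, r))
             (v : seq 'cV[rat]_r),
        column_basis (mx_of e e (Ave_sgn l s)) B ->
        basis_of (nullspace (D *m B)) v ->
        is_basis (@harm_Gamma_sgn l s) [seq uncoords e (B *m z) | z <- v]].
Proof.
split=> [|r B v cB bv|s r B v cB bv].
- rewrite dimvf /=.
  (* The number of monomials of degree l in three variables, turned by symmetry into the binomial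
     coefficient of l + 2 over 2. *)
  rewrite (_ : dim _ = 'C(l + 2, l)) // -bin_sub ?leq_addr // addKn bin2 addn2.
  by rewrite mulnC divn2.
- apply: (is_basis_harm_image _ _ _ Ave _ _ _ _ he he' _ _ cB bv).
    by move=> f; apply: Ave_homog.
  by move=> f; rewrite -imAve.
- apply: (is_basis_harm_image _ _ _ (Ave_sgn l s) _ _ _ _ he he' _ _ cB bv).
    by move=> f; apply: Ave_sgn_homog.
  by move=> f; rewrite -imAve_sgn; split=> [[[? ?] ?]|[? [? ?]]].
Qed.
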